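(* Let $k$ be even, and let $(V,W)$ be a weighted hypergraph with $V=\{1,\dots,n\}$ and adjacency tensor $W=(w_{i_1,\dots,i_k})$ of order $k$. Let $$S(W)=\{W'=(w'_{i_1,\dots,i_k}):\ (V,W')\text{ is a signed weighted hypergraph with }|w'_{i_1,\dots,i_k}|=w_{i_1,\dots,i_k}\ \forall i_1,\dots,i_k\in V\}.$$ Then for every $m=1,\dots,n$, $$\min_{U\subset V,\ \#U=m}\ \max_{i\in U}\deg_U(i)\ \ge\ \max_{W'\in S(W)}\max\{\lambda_m(W'),\,-\lambda'_m(W')\},$$ where $\deg_U(i):=\sum_{i_1,\dots,i_{k-1}\in U}w_{i,i_1,\dots,i_{k-1}}$ is the degree of the vertex $i$ in the sub-hypergraph $(U,W|_U)$.
   Context: A signed weighted hypergraph is a pair $(V,W)$ of a vertex set $V=\{1,\dots,n\}$ and a real symmetric tensor $W=(w_{i_1,\dots,i_k})_{i_1,\dots,i_k\in V}$ of order $k$ (invariant under permutations of the indices); it is a weighted hypergraph if all $w_{i_1,\dots,i_k}\ge0$. $\lambda_m(W')$ and $\lambda'_m(W')$ are the $m$-th min-max and max-min eigenvalues of the function pair $F(x)=\sum_{i_1,\dots,i_k}w'_{i_1,\dots,i_k}x_{i_1}\cdots x_{i_k}$, $G(x)=\sum_ix_i^k$: $$\lambda_m(W')=\inf_{\mathrm{genus}(A)\ge m}\sup_{x\in A}\frac{F(x)}{G(x)},\qquad\lambda'_m(W')=\sup_{\mathrm{genus}(A)\ge m}\inf_{x\in A}\frac{F(x)}{G(x)},$$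 $A$ ranging over compact symmetric subsets of $\mathbb R^n\setminus\{0\}$; the genus of a nonempty symmetric set is the least $s\ge1$ such that it admits an odd continuous map to $\mathbb S^{s-1}$. *)

(* Defs.v *)
From HB Require Import structures.
From mathcomp Require Import all_boot all_order all_algebra.
From mathcomp Require Import all_classical all_reals all_analysis.
Import Order.TTheory GRing.Theory Num.Theory.
Import numFieldNormedType.Exports.

Set Implicit Arguments.
Unset Strict Implicit.
Unset Printing Implicit Defensive.

Local Open Scope classical_set_scope.
Local Open Scope ring_scope.

(* An entry w_{i_1, ..., i_k} is [w t] with t : k.-tuple 'I_n the tuple of its
   indices; the vertex set is 'I_n. *)
Definition tensor (R : realType) (n k : nat) := k.-tuple 'I_n -> R.

Definition symmetric_tensor (R : realType) (n k : nat) (w : tensor R n k) :=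
  forall t t' : k.-tuple 'I_n, perm_eq t t' -> w t = w t'.

Definition signed_weighted_hypergraph (R : realType) (n k : nat)
    (w : tensor R n k) := symmetric_tensor w.

Definition weighted_hypergraph (R : realType) (n k : nat) (w : tensor R n k) :=
  signed_weighted_hypergraph w /\ forall t, 0 <= w t.

Definition signings (R : realType) (n k : nat) (w : tensor R n k) :
    set (tensor R n k) :=
  [set w' | signed_weighted_hypergraph w' /\ forall t, `|w' t| = w t].

(* The (k-1)-tuples (i_1, ..., i_{k-1}) of elements of U are represented by
   the k-tuples with head i whose remaining entries all lie in U. *)
Definition deg (R : realType) (n k : nat) (w : tensor R n k)
    (U : {set 'I_n}) (i : 'I_n) : R :=
  \sum_(t : k.-tuple 'I_n |
          (ohead t == Some i) && all (fun j => j \in U) (behead t)) w t.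

Definition tensor_form (R : realType) (n k : nat) (w : tensor R n k)
    (x : 'rV[R]_n) : R :=
  \sum_(t : k.-tuple 'I_n) w t * \prod_(i <- t) x 0 i.

Definition power_form (R : realType) (n k : nat) (x : 'rV[R]_n) : R :=
  \sum_(i < n) x 0 i ^+ k.

Definition rayleigh (R : realType) (n k : nat) (w : tensor R n k)
    (x : 'rV[R]_n) : R :=
  tensor_form w x / power_form k x.

Definition symmetric_set (R : realType) (n : nat) (A : set 'rV[R]_n) :=
  forall x, A x -> A (- x).

Definition unit_sphere (R : realType) (s : nat) : set 'rV[R]_s :=
  [set y | \sum_(j < s) y 0 j ^+ 2 = 1].

(* The unit sphere of 'rV_s is S^(s-1). *)
Definition odd_map_to_sphere (R : realType) (n : nat) (A : set 'rV[R]_n)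
    (s : nat) :=
  exists f : 'rV[R]_n -> 'rV[R]_s,
    [/\ {within A, continuous f},
        forall x, A x -> unit_sphere (f x)
      & forall x, A x -> f (- x) = - f x].

(* The infimum, in the extended reals, of a set of positive integers is its
   least element; it is +oo when there is no odd map to any sphere. *)
Definition genus (R : realType) (n : nat) (A : set 'rV[R]_n) : \bar R :=
  ereal_inf [set (s%:R)%:E | s in [set s : nat |
    (1 <= s)%N /\ odd_map_to_sphere A s]].

(* Nonemptiness is required because the genus is only meant for nonempty
   sets (the formula above would give the empty set genus 1). *)
Definition genus_family (R : realType) (n m : nat) : set (set 'rV[R]_n) :=
  [set A | [/\ compact A, symmetric_set A, ~ A 0, A !=set0
             & ((m%:R)%:E <= genus A)%E]].

Definition minmax_eigenvalue (R : realType) (n k : nat) (w : tensor R n k)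
    (m : nat) : \bar R :=
  ereal_inf [set ereal_sup [set (rayleigh w x)%:E | x in A]
            | A in @genus_family R n m].

Definition maxmin_eigenvalue (R : realType) (n k : nat) (w : tensor R n k)
    (m : nat) : \bar R :=
  ereal_sup [set ereal_inf [set (rayleigh w x)%:E | x in A]
            | A in @genus_family R n m].

Lemma signings_neq0 (R : realType) (n k : nat) (w : tensor R n k) :
  weighted_hypergraph w -> signings w !=set0.
Proof.
by move=> [symw w_ge0]; exists w; split=> // t; rewrite ger0_norm.
Qed.

Lemma finite_signings (R : realType) (n k : nat) (w : tensor R n k) :
  finite_set (signings w).
Proof.
pose g (e : {ffun k.-tuple 'I_n -> bool}) : tensor R n k :=
  fun t => if e t then w t else - w t.
apply: (@sub_finite_set _ _ (range g)); last exact/finite_image/finite_finset.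
move=> w' [_ absw']; exists [ffun t => 0 <= w' t] => //.
apply/funext => t; rewrite /g ffunE -absw'.
by case: ger0P => // _; rewrite opprK.
Qed.

(* Suprema over the set of signings are maxima. *)
Lemma signings_sup_attained (R : realType) (n k : nat) (w : tensor R n k)
    (f : tensor R n k -> \bar R) : weighted_hypergraph w ->
  exists2 w', signings w w' & ereal_sup [set f w' | w' in signings w] = f w'.
Proof.
move=> /signings_neq0 [w0 w0S].
have /finite_seqP [s defS] : finite_set (f @` signings w).
  exact/finite_image/finite_signings.
have [b bs b_ub] : exists2 b, b \in s & forall a, a \in s -> (a <= b)%E.
  have : [set` s] (f w0) by rewrite -defS; exists w0.
  rewrite /mkset.
  elim: s {defS} (f w0) => // a s IHs c _.
  case: s IHs => [_|a' s IHs].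
    by exists a; rewrite ?mem_head// => x; rewrite inE => /eqP ->.
  have [b bs b_ub] := IHs a' (mem_head _ _).
  have [ab|ba] := leP a b.
    exists b; first by rewrite inE bs orbT.
    by move=> x; rewrite inE => /predU1P[->//|/b_ub].
  exists a; first exact: mem_head.
  by move=> x; rewrite inE => /predU1P[->//|/b_ub /le_trans -> //]; exact: ltW.
have [w' w'S fw'] : (f @` signings w) b by rewrite defS.
exists w' => //; apply/le_anti/andP; split; last first.
  by apply: ereal_sup_ubound; exists w'.
apply: ge_ereal_sup => a; rewrite defS fw' => /b_ub; exact.
Qed.

(* Main.v *)
Require Import Defs.
From HB Require Import structures.
From mathcomp Require Import all_boot all_order all_algebra.
From mathcomp Require Import all_classical all_reals all_analysis.
From mathcomp Require Import perm zify lra.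
Import Order.TTheory GRing.Theory Num.Theory.
Import numFieldNormedType.Exports.
Local Open Scope classical_set_scope.
Local Open Scope ring_scope.

Set Implicit Arguments.
Unset Strict Implicit.
Unset Printing Implicit Defensive.

(** Fix U with m elements and test both eigenvalues on a single set, the unit
    sphere S of the coordinate subspace R^U ([coordinate_sphere]).

    On R^U the arithmetic-geometric mean inequality bounds each monomial
    |x_(i_1) ... x_(i_k)| by the mean of the x_(i_p)^k.  Summing with weights
    w = |w'| and using the symmetry of w to move every index to the front
    gives |F(x)| <= \sum_(i in U) deg_U(i) x_i^k ([tensor_form_le]), so that
    all Rayleigh quotients on S lie in [-max deg_U, max deg_U].

    The sphere S competes in the definition of both eigenvalues because its
    genus is at least m, which is the Borsuk-Ulam theorem ([borsuk_ulam]): a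
    map R^(d+1) \ 0 -> R^s that is continuous and odd has a zero if s <= d.
    It is deduced from a combinatorial statement on the cubical grid
    ([discrete_borsuk_ulam]).  Let a_0, ..., a_(d-1) be functions with values
    in Z/2 on the cells of [-2N, 2N]^d, and put D_0 = 1 and
    D_(k+1) = delta (a_k D_k), where delta is the cellular coboundary.  This
    is a cellular form of the cup product of the delta a_i.
    - D_(k+1)(v) can be nonzero only if a_k takes different values at v and at
      some facet u of v with D_k(u) nonzero, since delta D_k = 0
      ([cupprod_step]).  So D_d(v) = 1 provides a cell v around which every
      a_i changes its value.
    - If the a_i behave like signs of the coordinates of an odd function on a
      hemisphere parametrised by the cube, then D_d has sum 1 over the
      top-dimensional cells: by Stokes it is a sum over the boundary of the
      cube, on which only the two faces orthogonal to the last axis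
      contribute, and by antipodality these add up to the same sum for D_(d-1)
      in dimension d - 1 ([sum_cells_cupprod]).
    Take for a_i the sign of the i-th coordinate of the odd map.  If the map had
    no zero, then by compactness, on a fine grid, each cell would have a
    coordinate of constant sign around it ([uniform_sign]), contradicting the
    first point. *)

(** * Cubical cochains modulo 2 *)

(** A cell of the cubical grid with vertices in (2Z)^nat is represented by its
    centre v : nat -> int; the cell extends by one unit in each direction in
    which v is odd, so its dimension is the number of odd coordinates, and its
    facets are obtained by adding 1 or -1 to an odd coordinate.  The negation
    of cells preserves the incidence relation.  Infinitely many coordinates
    are allowed so that all faces of a box have the same type. *)
Definition upd (v : nat -> int) (j : nat) (x : int) : nat -> int :=
  fun l => if l == j then x else v l.

Definition oddz (x : int) : bool := odd `|x|%N.

Lemma oddzD x y : oddz (x + y) = oddz x (+) oddz y.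
Proof. rewrite /oddz; lia. Qed.
Lemma oddzN x : oddz (- x) = oddz x. Proof. by rewrite /oddz abszN. Qed.

Lemma upd_same v j x : upd v j x j = x. Proof. by rewrite /upd eqxx. Qed.
Lemma upd_diff v j x l : l != j -> upd v j x l = v l.
Proof. by rewrite /upd => /negPf ->. Qed.
Lemma upd_id v j : upd v j (v j) = v.
Proof. by apply/funext => l; rewrite /upd; case: eqP => [->|]. Qed.
Lemma updC v i j x y : i != j -> upd (upd v i x) j y = upd (upd v j y) i x.
Proof.
move=> ij; apply/funext => l; rewrite /upd.
by case: (l =P j) => // ->; rewrite eq_sym (negPf ij).
Qed.
Lemma upd_upd v j x y : upd (upd v j x) j y = upd v j y.
Proof. by apply/funext => l; rewrite /upd; case: eqP. Qed.

(** Cochains have coefficients in the field with two elements, which is bool with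
    exclusive or as addition. *)
Definition cob_dir (F : (nat -> int) -> bool) (j : nat) (v : nat -> int) : bool :=
  if oddz (v j) then F (upd v j (v j - 1)) + F (upd v j (v j + 1)) else 0.

Definition cob (d : nat) (F : (nat -> int) -> bool) (v : nat -> int) : bool :=
  \sum_(j < d) cob_dir F j v.

(** The cup product of the coboundaries of a_0, ..., a_(k-1).  Since it is itself
    the coboundary of a cochain, Stokes' formula applies to it directly. *)
Fixpoint cupprod (d : nat) (a : nat -> (nat -> int) -> bool) (k : nat) :
    (nat -> int) -> bool :=
  if k is k'.+1 then cob d (fun v => a k' v * cupprod d a k' v) else fun=> 1.

Lemma addrr_bool (x : bool) : x + x = 0. Proof. by case: x. Qed.

Lemma addb_or (x y : bool) : (x + y)%R -> x \/ y.
Proof. by case: x => xy; [left|right]. Qed.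

Lemma sum_sym_bool d (E : nat -> nat -> bool) :
  (forall i, E i i = 0) -> (forall i j, E i j = E j i) ->
  \sum_(i < d) \sum_(j < d) E i j = 0.
Proof.
move=> E0 Esym; elim: d => [|d IHd]; first by rewrite big_ord0.
rewrite big_ord_recr big_ord_recr /= E0 addr0.
under eq_bigr do rewrite big_ord_recr /=.
rewrite big_split /= IHd add0r -[RHS](addrr_bool (\sum_(i < d) E d i)).
by congr (_ + _); apply: eq_bigr => i _.
Qed.

(** A face of codimension 2 is reached through two directions in either order,
    hence is counted twice. *)
Lemma cob_cob d F v : cob d (cob d F) v = 0.
Proof.
rewrite /cob.
have -> : \sum_(j < d) cob_dir (cob d F) j v =
   \sum_(j < d) \sum_(i < d) cob_dir (cob_dir F i) j v.
  apply: eq_bigr => j _; rewrite /cob_dir /cob; case: ifP => _.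
    by rewrite -big_split.
  by rewrite big1.
apply: (sum_sym_bool d (E := fun j i => cob_dir (cob_dir F i) j v)) => [i|j i].
  rewrite /cob_dir !upd_same; case: ifP => // vi.
  by rewrite !oddzD vi.
have [->//|ij] := eqVneq i j.
rewrite /cob_dir !upd_diff// 1?eq_sym// !(@updC v i j)//.
by case: (oddz _); case: (oddz _); rewrite ?addr0// addrACA.
Qed.

(** Each D_k is a coboundary, except for D_0 = 1, which is a cocycle because an
    edge has two ends. *)
Lemma cob_cupprod d a k v : cob d (cupprod d a k) v = 0.
Proof.
case: k => [|k]; last exact: cob_cob.
by rewrite /cob big1// => j _; rewrite /cob_dir; case: ifP.
Qed.

(** As D_k is a cocycle, D_(k+1)(v) is also the sum over the facets w of v of
    (a_k(w) + a_k(v)) D_k(w). *)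
Lemma cupprod_step d a k v : cupprod d a k.+1 v ->
  exists w, [/\ cupprod d a k w, a k w != a k v
    & forall l, `|w l - v l| <= 1].
Proof.
move=> Dv; have: cupprod d a k.+1 v + a k v * cob d (cupprod d a k) v = true.
  by rewrite cob_cupprod mulr0 addr0 Dv.
rewrite /= /cob mulr_sumr -big_split /= => Dsum.
have [j] : exists j : 'I_d,
    cob_dir (fun w => (a k w + a k v) * cupprod d a k w) j v.
  apply: contrapT => D0; move: Dsum; rewrite big1// => j _.
  have /negP/negPf : ~ cob_dir (fun w => (a k w + a k v) * cupprod d a k w) j v.
    by move=> Dj; apply: D0; exists j.
  rewrite /cob_dir.
  case: ifP => _; last by rewrite mulr0.
  by case: (a k v); do 2!(case: (a k _)); do 2!(case: (cupprod _ _ _ _)).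
rewrite /cob_dir; case: ifP => // _.
have ok e : `|e| <= 1 -> ((a k (upd v j (v j + e)) + a k v) *
      cupprod d a k (upd v j (v j + e)))%R ->
    exists w, [/\ cupprod d a k w, a k w != a k v
    & forall l, `|w l - v l| <= 1].
  move=> e1 /andP[a_ D_]; exists (upd v j (v j + e)); split=> //.
  - by move: a_; do 2!case: (a k _).
  - by move=> l; rewrite /upd; case: eqP => [->|_]; lia.
by case/addb_or => [/(ok (-1) isT)|/(ok 1 isT)].
Qed.

Lemma cupprod_flag d a k v : cupprod d a k v -> forall i, (i < k)%N ->
  exists p q, a i p != a i q /\
    forall l, `|p l - v l| <= k%:Z /\ `|q l - v l| <= k%:Z.
Proof.
elim: k v => // k IHk v /cupprod_step [w [Dw aw wv]] i; rewrite ltnS leq_eqVlt.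
case/predU1P => [->|ik].
  by exists w, v; split=> // l; have := wv l; lia.
have [p [q [apq pqw]]] := IHk w Dw i ik; exists p, q; split=> // l.
by have := wv l; have := pqw l; lia.
Qed.

(** * Integration over boxes and Stokes' formula *)

(** The odd numbers 2c + 1 - 2N, for c < 2N, are the centres of the edges of
    [-2N, 2N]. *)
Definition sum_dir (N : nat) (j : nat) (F : (nat -> int) -> bool)
    (v : nat -> int) : bool :=
  \sum_(c < N.*2) F (upd v j ((c.*2.+1)%:Z - N.*2%:Z)).

Definition sum_cells N js F := foldr (sum_dir N) F js.

(** Stokes' formula in one direction: a telescoping sum. *)
Lemma stokes_dir N j F v : sum_dir N j (cob_dir F j) v =
  F (upd v j (- N.*2%:Z)) + F (upd v j N.*2%:Z).
Proof.
rewrite /sum_dir.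
pose G c := F (upd v j (c.*2%:Z - N.*2%:Z)).
transitivity (\sum_(0 <= c < N.*2) (G c + G c.+1)).
  rewrite big_mkord; apply: eq_bigr => c _; rewrite /cob_dir upd_same !upd_upd.
  case: ifP; last by rewrite /oddz; lia.
  by move=> _; rewrite /G; congr (F (upd _ _ _) + F (upd _ _ _)); lia.
rewrite (telescope_big (fun i k => G i + G k)); last first.
  by move=> k _; case: (G 0%N); case: (G k); case: (G k.+1).
case: ltnP => N0; rewrite /G.
  by congr (F (upd _ _ _) + F (upd _ _ _)); lia.
by rewrite (_ : N = 0%N) ?oppr0 ?addrr_bool//; lia.
Qed.

Lemma sum_dirC N i j F : i != j ->
  sum_dir N i (sum_dir N j F) = sum_dir N j (sum_dir N i F).
Proof.
move=> ij; apply/funext => v; rewrite /sum_dir exchange_big.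
by apply: eq_bigr => c _; apply: eq_bigr => c' _; rewrite updC.
Qed.

Lemma sum_cells_rem N js j F : uniq js -> j \in js ->
  sum_cells N js F = sum_cells N (rem j js) (sum_dir N j F).
Proof.
elim: js => //= i js IH /andP[ijs ujs]; rewrite inE.
case: (eqVneq j i) => [-> _|ji /=]; last first.
  by move=> jjs; rewrite IH.
elim: js ijs {IH ujs} => //= l js IHl.
by rewrite inE negb_or => /andP[il ijs]; rewrite sum_dirC// IHl.
Qed.

Lemma sum_cellsD N js (F G : (nat -> int) -> bool) v :
  sum_cells N js (fun u => F u + G u) v = sum_cells N js F v + sum_cells N js G v.
Proof.
elim: js v => //= j js IH v; rewrite /sum_dir -big_split /=.
by apply: eq_bigr => c _; rewrite IH.
Qed.

Lemma sum_cells_sum N js d (F : 'I_d -> (nat -> int) -> bool) v :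
  sum_cells N js (fun u => \sum_(i < d) F i u) v =
    \sum_(i < d) sum_cells N js (F i) v.
Proof.
elim: js v => //= j js IH v; rewrite /sum_dir exchange_big /=.
by apply: eq_bigr => c _; rewrite IH.
Qed.

(** The cells over which [sum_cells N js F v] extends: those of the box with
    directions js through v that have full dimension in the box. *)
Definition cell_of N (js : seq nat) (v u : nat -> int) := forall l,
  if l \in js then oddz (u l) /\ `|u l| <= N.*2%:Z else u l = v l.

Lemma cell_of_upd N j js v u (c : 'I_N.*2) : j \notin js ->
  cell_of N js (upd v j ((c.*2.+1)%:Z - N.*2%:Z)) u -> cell_of N (j :: js) v u.
Proof.
move=> jjs cu l; rewrite inE; have := cu l; case: (eqVneq l j) => [->|lj].
  rewrite (negPf jjs) /= upd_same => ->; split; rewrite ?/oddz; first lia.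
  by have := ltn_ord c; lia.
by rewrite upd_diff.
Qed.

(** Two boxes with the same directions but through different base cells are
    compared cell by cell; used when a cochain does not see the coordinates
    in which the base cells differ. *)
Lemma eq_sum_cells_base N js F G v w : uniq js ->
  (forall u u', cell_of N js v u -> cell_of N js w u' ->
     (forall l, l \in js -> u l = u' l) -> F u = G u') ->
  sum_cells N js F v = sum_cells N js G w.
Proof.
elim: js v w => [|j js IH] v w /=; first by move=> _; apply.
move=> /andP[jjs ujs] FG; rewrite /sum_dir; apply: eq_bigr => c _.
apply: IH => // u u' cu cu' uu'; apply: FG => [||l].
- exact: cell_of_upd cu.
- exact: cell_of_upd cu'.
rewrite inE => /predU1P[->|]; last exact: uu'.
by have := cu j; have := cu' j; rewrite (negPf jjs) !upd_same => -> ->.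
Qed.

Lemma eq_sum_cells N js F G v : uniq js ->
  (forall u, cell_of N js v u -> F u = G u) ->
  sum_cells N js F v = sum_cells N js G v.
Proof.
move=> ujs FG; apply: eq_sum_cells_base => // u u' cu cu' uu'.
rewrite FG//; congr G; apply/funext => l; have := cu l; have := cu' l.
by case: ifP => [/uu'|_ -> ->].
Qed.

Lemma sum_cells0 N js v : sum_cells N js (fun=> 0) v = 0.
Proof. by elim: js v => //= j js IH v; rewrite /sum_dir big1. Qed.

Lemma sum_cells_ex N js F v : uniq js -> sum_cells N js F v ->
  exists2 u, cell_of N js v u & F u.
Proof.
move=> ujs Fv; apply: contrapT => nF; move: Fv.
rewrite (@eq_sum_cells _ _ _ (fun=> 0)) ?sum_cells0// => u cu.
by apply/negbTE/negP => Fu; apply: nF; exists u.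
Qed.

Lemma sum_cells_opp N js F v : sum_cells N js F v =
  sum_cells N js (fun u => F (fun l => - u l)) (fun l => - v l).
Proof.
elim: js v => [|j js IH] v /=.
  by congr F; apply/funext => l; rewrite opprK.
rewrite /sum_dir [RHS](reindex_inj rev_ord_inj) /=; apply: eq_bigr => c _.
rewrite IH; congr (sum_cells _ _ _ _); apply/funext => l; rewrite /upd.
by case: eqP => // _; have := ltn_ord c; lia.
Qed.

(** * A discrete Borsuk-Ulam theorem *)

(** The cube is a model of a hemisphere in which, on a face orthogonal to the
    j-th axis, all later coordinates are collapsed; see [shrink] below. *)
Definition face_local (d N : nat) (a : nat -> (nat -> int) -> bool) :=
  forall i j v w, (j < d)%N -> `|v j| = N.*2%:Z ->
    (forall l, (l <= j)%N -> v l = w l) -> a i v = a i w.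

(** The boundary of the cube models the equator of the hemisphere, where the
    antipodal map is the negation. *)
Definition face_antipodal (d N : nat) (a : nat -> (nat -> int) -> bool) :=
  forall i j v, (j < d)%N -> `|v j| = N.*2%:Z ->
    a i (fun l => - v l) = ~~ a i v.

Lemma oddz_face N x : `|x| = N.*2%:Z -> oddz x = false.
Proof. by rewrite /oddz; lia. Qed.

(** The parities of the coordinates determine the directions in which v and w
    extend, so their faces correspond to each other, and corresponding faces
    agree up to the j-th coordinate. *)
Lemma cupprod_local d N a k j v w : face_local d N a ->
    (j < d)%N -> `|v j| = N.*2%:Z -> (forall l, (l <= j)%N -> v l = w l) ->
    (forall l, oddz (v l) = oddz (w l)) ->
  cupprod d a k v = cupprod d a k w.
Proof.
move=> aloc jd; elim: k v w => //= k IHk v w vj vw ovw.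
rewrite /cob; apply: eq_bigr => l _; rewrite /cob_dir -ovw; case: ifP => // ol.
have lj : l != j :> nat by apply: contraTneq ol => ->; rewrite (oddz_face vj).
have face e : oddz e = true -> upd v l (v l + e) j = v j /\
   (forall i, (i <= j)%N -> upd v l (v l + e) i = upd w l (w l + e) i) /\
   forall i, oddz (upd v l (v l + e) i) = oddz (upd w l (w l + e) i).
  move=> oe; split; [|split=> i]; first by rewrite upd_diff 1?eq_sym.
    by move=> ij; rewrite /upd; case: eqP => [<-|_]; rewrite vw.
  by rewrite /upd; case: eqP => // _; rewrite !oddzD ovw.
have facet e : oddz e = true ->
    a k (upd v l (v l + e)) * cupprod d a k (upd v l (v l + e)) =
    a k (upd w l (w l + e)) * cupprod d a k (upd w l (w l + e)).
  move=> /face [fj [fl fo]]; congr (_ * _)%R.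
    by apply: (aloc _ _ _ _ jd _ fl); rewrite fj.
  by apply: IHk => //; rewrite fj.
by rewrite !facet.
Qed.

(** Replacing each a_i by 1 + a_i on a cell and its faces does not change the
    differences of values that D_k depends on; concretely, it adds
    delta D_k = 0 to D_(k+1). *)
Lemma cupprod_opp d N a k j v : face_antipodal d N a ->
    (j < d)%N -> `|v j| = N.*2%:Z ->
  cupprod d a k (fun l => - v l) = cupprod d a k v.
Proof.
move=> aopp jd; elim: k v => // k IHk v vj.
pose w := fun l => - v l.
have facet l e : l != j -> cupprod d a k (upd w l (w l - e)) =
      cupprod d a k (upd v l (v l + e)) /\
    a k (upd w l (w l - e)) = ~~ a k (upd v l (v l + e)).
  move=> lj; have -> : upd w l (w l - e) = fun i => - (upd v l (v l + e) i).
    by apply/funext => i; rewrite /w /upd; case: eqP => // _; rewrite opprD.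
  have fj : `|upd v l (v l + e) j| = N.*2%:Z by rewrite upd_diff// eq_sym.
  by rewrite IHk// (aopp _ j).
rewrite -[LHS]addr0 -[X in _ + X](cob_cupprod d a k v).
rewrite /= /cob -big_split /=; apply: eq_bigr => l _; rewrite /cob_dir oddzN.
case: ifP => // ol.
have lj : l != j :> nat by apply: contraTneq ol => ->; rewrite (oddz_face vj).
have [-> ->] := facet l 1 lj; have := facet l (-1) lj; rewrite opprK => -[-> ->].
by do 2!case: (a k _); do 2!case: (cupprod _ _ _ _).
Qed.

(** On a face orthogonal to the j-th axis the a_i do not depend on the e-th
    coordinate for e > j, so on a cell of dimension at most k that extends in
    the direction e the contributions to D_k of the two facets orthogonal to
    the e-th axis cancel, and the other facets again extend in the direction
    e.  The list s bounds the set of directions of the cell. *)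
Lemma cupprod_side d N a k (s : seq nat) j e v : face_local d N a ->
    (j < e)%N -> (e < d)%N -> `|v j| = N.*2%:Z -> oddz (v e) ->
    (forall l, (l < d)%N -> oddz (v l) -> l \in s) -> (size s <= k)%N ->
  cupprod d a k v = 0.
Proof.
move=> aloc je ed; elim: k v s => [|k IHk] v s vj oe vs.
  by rewrite leqn0 => /nilP s0; have := vs _ ed oe; rewrite s0.
move=> sk; rewrite /= /cob big1// => l _; rewrite /cob_dir; case: ifP => // ol.
have lj : l != j :> nat by apply: contraTneq ol => ->; rewrite (oddz_face vj).
have [le|le] := eqVneq (l : nat) e.
  have vj' x : `|upd v l x j| = N.*2%:Z by rewrite upd_diff// eq_sym.
  rewrite -[RHS](addrr_bool (a k (upd v l (v l + 1)) *
    cupprod d a k (upd v l (v l + 1)))).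
  congr (_ * _ + _)%R.
    apply: (aloc _ _ _ _ (ltn_trans je ed) (vj' _)) => i ij.
    by rewrite !upd_diff//; lia.
  apply: (cupprod_local _ aloc (ltn_trans je ed) (vj' _)) => i.
    by move=> ij; rewrite !upd_diff//; lia.
  by rewrite /upd; case: eqP => // _; rewrite !oddzD.
have facet x : oddz x = false -> cupprod d a k (upd v l x) = 0.
  move=> ox; apply: (IHk _ (rem (l : nat) s)).
  - by rewrite upd_diff// eq_sym.
  - by rewrite upd_diff// eq_sym.
  - move=> i id; rewrite /upd; case: eqVneq => [_|il]; first by rewrite ox.
    by move=> /(vs _ id); exact: rem_mem.
  - by rewrite size_rem ?vs// -subn1 leq_subLR add1n.
by rewrite !facet ?mulr0 ?addr0// oddzD ol.
Qed.

(** Induction on e.  By Stokes' formula the sum of D_(e+1) = delta (a_e D_e) is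
    a sum of a_e D_e over the facets of the box.  D_e vanishes on the facets
    orthogonal to the axes j < e.  On the two opposite facets orthogonal to the
    axis e, antipodality turns a_e D_e into (1 + a_e) D_e and a_e D_e, whose
    sum is D_e. *)
Lemma sum_cells_cupprod d N a e : face_local d N a -> face_antipodal d N a ->
  (e <= d)%N ->
  sum_cells N (iota 0 e) (cupprod d a e) (fun=> N.*2%:Z) = 1.
Proof.
move=> aloc aopp; elim: e => // e IHe ed.
set v0 := (fun=> _ : int); pose js := iota 0 e.+1.
pose G u := a e u * cupprod d a e u.
have ujs : uniq js := iota_uniq _ _.
have mjs l : (l \in js) = (l <= e)%N by rewrite mem_iota.
have v0E : `|N.*2%:Z| = N.*2%:Z by [].
rewrite -/js (_ : sum_cells _ _ _ _ =
  \sum_(j < d) sum_cells N js (cob_dir G j) v0); last first.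
  exact: (sum_cells_sum _ _ (fun j : 'I_d => cob_dir G j)).
have rjs j : (j <= e)%N -> uniq (rem j js) /\
     forall l, (l \in rem j js) = (l != j) && (l <= e)%N.
  by move=> je; split; rewrite ?rem_uniq// => l; rewrite mem_rem_uniq// -mjs.
have vanish (j : 'I_d) : j != e :> nat -> sum_cells N js (cob_dir G j) v0 = 0.
  move=> jne; case: (ltnP e j) => je.
    rewrite -[RHS](sum_cells0 N js v0).
    apply: eq_sum_cells => // u /(_ j); rewrite mjs leqNgt je /= => uj.
    by rewrite /cob_dir uj (oddz_face v0E).
  have jlt : (j < e)%N by rewrite ltn_neqAle jne.
  have [urj mrj] := rjs j je.
  rewrite (@sum_cells_rem N js j) ?mjs//.
  rewrite -[RHS](sum_cells0 N (rem (j : nat) js) v0).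
  apply: eq_sum_cells => // u cu; rewrite stokes_dir /G.
  have face x : `|x| = N.*2%:Z -> cupprod d a e (upd u j x) = 0.
    move=> xE; apply: (cupprod_side (N := N) (s := rem (j : nat) js) (j := j)
      (e := e)) => //.
    - by rewrite upd_same.
    - rewrite upd_diff 1?eq_sym//; have := cu e; rewrite mrj eq_sym jne leqnn.
      by case.
    - move=> l _; rewrite /upd; case: eqVneq => [_|lj].
        by rewrite (oddz_face xE).
      by have := cu l; case: ifP => // _ ->; rewrite (oddz_face v0E).
    - by rewrite size_rem ?mjs// size_iota.
  by rewrite !face ?normrN// !mulr0 addr0.
rewrite (bigD1 (Ordinal ed))// big1 ?addr0; last first.
  by move=> j /= je; apply: vanish.
have [urj mrj] := rjs e (leqnn e).
rewrite (@sum_cells_rem N js e) ?mjs//.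
have -> : rem e js = iota 0 e.
  rewrite rem_filter// /js -addn1 iotaD filter_cat /= add0n eqxx cats0.
  by apply/all_filterP/allP => l; rewrite mem_iota /=; lia.
have -> : sum_dir N e (cob_dir G e) =
    fun u => G (upd u e (- N.*2%:Z)) + G (upd u e N.*2%:Z).
  by apply/funext => u; rewrite stokes_dir.
rewrite sum_cellsD [X in X + _]sum_cells_opp.
have uje : uniq (iota 0 e) := iota_uniq _ _.
(* The facet x_e = -2N is transported to the facet x_e = 2N by negation; the
   later coordinates are not returned to 2N, but locality makes this harmless. *)
have antip : sum_cells N (iota 0 e)
      (fun u => G (upd (fun l => - u l) e (- N.*2%:Z))) (fun l => - v0 l) =
    sum_cells N (iota 0 e) (fun u => ~~ a e u * cupprod d a e u) v0.
  apply: eq_sum_cells_base => // u u' cu cu' uu'; pose w := upd u e N.*2%:Z.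
  have -> : upd (fun l => - u l) e (- N.*2%:Z) = fun l => - w l.
    by apply/funext => l; rewrite /w /upd; case: eqP.
  have we : `|w e| = N.*2%:Z by rewrite /w upd_same.
  have u'e l : (e <= l)%N -> u' l = N.*2%:Z.
    by have := cu' l; rewrite mem_iota add0n ltnNge /= => /[swap] ->.
  have wu' l : (l <= e)%N -> w l = u' l.
    rewrite leq_eqVlt => /predU1P[->|le]; first by rewrite /w upd_same u'e.
    by rewrite /w upd_diff ?uu' ?mem_iota//; lia.
  rewrite /G (aopp _ _ _ ed we) (cupprod_opp _ aopp ed we).
  rewrite (aloc _ _ _ _ ed we wu') (cupprod_local _ aloc ed we wu')// => l.
  have [le|le] := leqP l e; first by rewrite wu'.
  rewrite u'e ?(ltnW le)// /w upd_diff ?gtn_eqF//.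
  have := cu l; rewrite mem_iota add0n ltnNge (ltnW le) /= => ->.
  by rewrite oddzN.
rewrite {}antip.
rewrite [X in _ + X](@eq_sum_cells _ _ _ (fun u => a e u * cupprod d a e u))//;
  last first.
  move=> u /(_ e); rewrite mem_iota add0n ltnn /= => ue.
  by rewrite -[N.*2%:Z]/(v0 e) -ue upd_id.
rewrite -sum_cellsD -[RHS](IHe (ltnW ed)) [LHS]addr0.
apply: eq_sum_cells => // u _.
by case: (a e u); case: (cupprod _ _ _ _).
Qed.

(** The cell u is one of those on which D_d = 1, and p, q are consecutive cells
    of a flag in u.  The crude bound d on their distance to u is enough, since
    d is small compared with the width 4N of the box when N is large. *)
Lemma discrete_borsuk_ulam d N a : face_local d N a -> face_antipodal d N a ->
  exists u : nat -> int,
    [/\ forall l, `|u l| <= N.*2%:Z, forall l, (d <= l)%N -> u l = N.*2%:Z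
      & forall i, (i < d)%N -> exists p q, a i p != a i q /\
          forall l, `|p l - u l| <= d%:Z /\ `|q l - u l| <= d%:Z].
Proof.
move=> aloc aopp; have /(sum_cells_ex (iota_uniq _ _)) [u cu Du] :
    sum_cells N (iota 0 d) (cupprod d a d) (fun=> N.*2%:Z).
  by rewrite sum_cells_cupprod.
exists u; split=> [l|l dl|]; last exact: (cupprod_flag Du).
  by have := cu l; case: ifP => [_ []|_ ->].
by have := cu l; rewrite mem_iota add0n ltnNge dl.
Qed.

(** * From the cube to the sphere *)

Lemma cvg_row (R : realType) n (T : Type) (F : set_system T) {FF : Filter F}
    (f : T -> 'rV[R]_n) (l : 'rV[R]_n) :
  (forall i, f x 0 i @[x --> F] --> l 0 i) -> f @ F --> l.
Proof.
move=> fl; apply/cvg_ballP => e e0.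
have : \forall x \near F, forall i, ball (l 0 i) e (f x 0 i).
  by apply: filter_forall => i; move: (fl i) => /cvg_ballP /(_ _ e0).
by apply: filterS => x fx; split=> // i j; rewrite ord1; exact: fx.
Qed.

(** The absolute values of the first coordinates |x_0|, (1 - |x_0|) |x_1|, ... add
    up to 1 as soon as x_d = 1 and all |x_j| <= 1, so the face x_d = 1 of the
    cube [-1, 1]^(d+1) is mapped to the upper half of the l^1-sphere.  The map is
    odd, and when |x_j| = 1 the coordinates after x_j are multiplied by 0: these
    are the properties [face_antipodal] and [face_local]. *)
Definition shrink (R : realType) (d : nat) (x : 'rV[R]_d.+1) : 'rV[R]_d.+1 :=
  \row_i (\prod_(j < d.+1 | (j < i)%N) (1 - `|x 0 j|) * x 0 i).

Lemma shrink_continuous (R : realType) d : continuous (@shrink R d).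
Proof.
move=> x; apply: (@cvg_row R _ _ (nbhs x)) => i.
under eq_cvg do rewrite mxE; rewrite mxE.
apply: cvgM; last exact: coord_continuous.
apply: cvg_big => [|j _]; first exact: mul_continuous.
apply: cvgB; first exact: cvg_cst.
by apply: cvg_norm; exact: coord_continuous.
Qed.

Lemma shrinkN (R : realType) d (x : 'rV[R]_d.+1) : shrink (- x) = - shrink x.
Proof.
apply/rowP => i; rewrite !mxE mulrN; congr (- (_ * _)).
by apply: eq_bigr => j _; rewrite mxE normrN.
Qed.

Lemma shrink_eq0 (R : realType) d (x : 'rV[R]_d.+1) : shrink x = 0 -> x = 0.
Proof.
move=> x0; apply/rowP => i; rewrite mxE.
have [m] := ubnP i; elim: m i => // m IH i; rewrite ltnS => im.
have /rowP/(_ i) := x0; rewrite !mxE big1 ?mul1r// => j ji.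
by rewrite IH ?normr0 ?subr0// (leq_trans ji).
Qed.

Lemma shrink_local (R : realType) d (x y : 'rV[R]_d.+1) (j : 'I_d.+1) :
  `|x 0 j| = 1 -> (forall l : 'I_d.+1, (l <= j)%N -> x 0 l = y 0 l) ->
  shrink x = shrink y.
Proof.
move=> xj xy; apply/rowP => i; rewrite !mxE; have [ij|ji] := leqP i j.
  rewrite xy//; congr (_ * _); apply: eq_bigr => l li.
  by rewrite xy// (leq_trans (ltnW li)).
rewrite (bigD1 j)//= [in RHS](bigD1 j)//= -xy// xj subrr.
by rewrite !mul0r.
Qed.

(** A sign for nonzero vectors which is reversed by negation: the choice of the
    coordinate j depends only on the support of x, which x and - x share. *)
Definition lead_pos (R : realType) n (x : 'rV[R]_n) : bool :=
  if [pick j | x 0 j != 0] is Some j then 0 < x 0 j else false.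

Lemma lead_posN (R : realType) n (x : 'rV[R]_n) : x != 0 ->
  lead_pos (- x) = ~~ lead_pos x.
Proof.
move=> x0; rewrite /lead_pos.
rewrite (@eq_pick _ _ (fun j => x 0 j != 0)); last first.
  by move=> j; rewrite mxE oppr_eq0.
case: pickP => [j xj|x_eq0].
  by rewrite mxE oppr_gt0 -leNgt le_eqVlt (negPf xj).
by move/eqP: x0; case; apply/rowP => j; rewrite mxE; apply/eqP/negbFE.
Qed.

(** The sign of t, where ties are broken by the vector x in order that the sign
    be reversed, even for t = 0, when (t, x) is negated. *)
Definition sign_of (R : realType) n (t : R) (x : 'rV[R]_n) : bool :=
  if t == 0 then lead_pos x else 0 < t.

Lemma sign_ofN (R : realType) n t (x : 'rV[R]_n) : x != 0 ->
  sign_of (- t) (- x) = ~~ sign_of t x.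
Proof.
move=> x0; rewrite /sign_of oppr_eq0 lead_posN//; case: eqVneq => // t0.
by rewrite oppr_gt0 -leNgt le_eqVlt (negPf t0).
Qed.

Lemma sign_of_mul (R : realType) n t t' (x x' : 'rV[R]_n) :
  0 < t * t' -> sign_of t x = sign_of t' x'.
Proof.
rewrite /sign_of => tt'; have : t * t' != 0 by rewrite gt_eqF.
rewrite mulf_eq0 negb_or => /andP[/negPf -> /negPf ->].
apply/idP/idP => t0; first by rewrite -(pmulr_rgt0 _ t0).
by rewrite -(pmulr_lgt0 _ t0).
Qed.

(** * The Borsuk-Ulam theorem *)

(** Around each point some coordinate of g has a constant sign; a Lebesgue number
    argument makes the size of the neighbourhood uniform. *)
Lemma uniform_sign (R : realType) n s (K : set 'rV[R]_n)
    (g : 'rV[R]_n -> 'rV[R]_s) : compact K ->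
    (forall x, K x -> {for x, continuous g}) -> (forall x, K x -> g x != 0) ->
  exists2 e : R, 0 < e & forall x, K x -> exists i : 'I_s, forall y z : 'rV[R]_n,
    (forall j, `|y 0 j - x 0 j| <= e) -> (forall j, `|z 0 j - x 0 j| <= e) ->
    0 < g y 0 i * g z 0 i.
Proof.
move=> /compact_near_coveringP Kcpt gcont g0.
pose P (e : R) (x : 'rV[R]_n) := exists i : 'I_s, forall y z : 'rV[R]_n,
    (forall j, `|y 0 j - x 0 j| <= e) -> (forall j, `|z 0 j - x 0 j| <= e) ->
    0 < g y 0 i * g z 0 i.
have : \forall e \near 0^'+, K `<=` P e.
  apply: Kcpt => x Kx.
  have [i gi0] : exists i, g x 0 i != 0.
    apply: contrapT => gx0; have /eqP := g0 x Kx; apply; apply/rowP => i.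
    by rewrite mxE; apply: contrapT => /eqP gi; apply: gx0; exists i.
  have positive_near (F : set_system 'rV[R]_n) : Filter F -> g @ F --> g x ->
      \forall y \near F, 0 < g y 0 i * g x 0 i.
    move=> FF gF; apply: (@cvgr_gt R _ F FF _ (g x 0 i * g x 0 i)).
      apply: cvgM; last exact: cvg_cst.
      exact: (cvg_comp g (fun M : 'rV[R]_s => M 0 i) gF
        (@coord_continuous R 1 s 0 i (g x))).
    by rewrite -expr2 exprn_even_gt0//=.
  have := positive_near _ (nbhs_filter x) (gcont x Kx).
  move=> /nbhs_ballP [e /= e0 xe].
  exists (ball x (e / 2), [set t | 0 < t < e / 2]) => /=.
    split; first by apply: nbhsx_ballx; lra.
    near=> t; apply/andP; split; near: t; first exact: nbhs_right_gt.
    by apply: nbhs_right_lt; lra.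
  move=> [x' t] /= [[_ xx'] /andP[t0 te]]; exists i => y z yx' zx'.
  have near_x (w : 'rV[R]_n) : (forall j, `|w 0 j - x' 0 j| <= t) ->
      0 < g w 0 i * g x 0 i.
    move=> wx'; apply: xe; split=> // a j; rewrite ord1 /ball /=.
    have := wx' j; have := xx' 0 j; rewrite /ball /= distrC => h1 h2.
    rewrite distrC; have := ler_distD (x' 0 j) (w 0 j) (x 0 j); lra.
  have := mulr_gt0 (near_x y yx') (near_x z zx').
  rewrite mulrACA pmulr_lgt0//.
  by rewrite -expr2 exprn_even_gt0//=.
move=> Pnear; have [e [e0 eP]] : exists e, 0 < e /\ K `<=` P e.
  near (0 : R)^'+ => e; exists e; split; first by near: e; exact: nbhs_right_gt.
  by near: e.
by exists e.
Unshelve. all: by end_near. Qed.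

(** The box [-2N, 2N]^(d+1) is scaled to [-1, 1]^(d+1). *)
Definition grid_point (R : realType) (d N : nat) (v : nat -> int) : 'rV[R]_d.+1 :=
  \row_i ((v i)%:~R / N.*2%:R).

Definition box_face (R : realType) d : set 'rV[R]_d.+1 :=
  [set x | forall i : 'I_d.+1,
     (if i == ord_max then [set 1] else `[-1, 1]%classic) (x 0 i)].

Lemma compact_box_face (R : realType) d : compact (@box_face R d).
Proof.
apply: (@rV_compact R d.+1 (fun i : 'I_d.+1 => 
  if i == ord_max then [set 1] else `[-1, 1]%classic)) => i.
by case: ifP => _; [exact: compact_set1|exact: segment_compact].
Qed.

(** The cells of the cube [-2N, 2N]^d are placed on the face x_d = 1, so that
    the d + 1 coordinates of a grid point never vanish simultaneously and
    [shrink] sends them to nonzero vectors. *)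
Lemma borsuk_ulam (R : realType) d s (h : 'rV[R]_d.+1 -> 'rV[R]_s) :
    (s <= d)%N -> (forall x : 'rV[R]_d.+1, x != 0 -> {for x, continuous h}) ->
    (forall x : 'rV[R]_d.+1, x != 0 -> h (- x) = - h x) ->
  exists2 x : 'rV[R]_d.+1, x != 0 & h x = 0.
Proof.
move=> sd hcont hodd; apply: contrapT => noz.
have h0 (x : 'rV[R]_d.+1) : x != 0 -> h x != 0.
  by move=> x0; apply/eqP => hx; apply: noz; exists x.
have shrink0 (x : 'rV[R]_d.+1) : x != 0 -> shrink x != 0.
  by apply: contra_neq; exact: shrink_eq0.
have K0 (x : 'rV[R]_d.+1) : box_face x -> x != 0.
  move=> /(_ ord_max); rewrite eqxx /= => x1.
  by apply/eqP => x0; move: x1; rewrite x0 mxE => /eqP; rewrite eq_sym oner_eq0.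
have [||e e0 sgn] := @uniform_sign R d.+1 s (@box_face R d) (h \o @shrink R d)
    (@compact_box_face R d).
- move=> x /K0 x0; apply: continuous_comp; first exact: shrink_continuous.
  exact/hcont/shrink0.
- by move=> x /K0 /shrink0 /h0.
(* A distance of d units between cells is at most e after scaling. *)
pose N := (Num.bound (d%:R / e)).+1.
have N20 : 0 < N.*2%:R :> R by rewrite ltr0n.
have Ne : d%:R / N.*2%:R <= e.
  rewrite ler_pdivrMr// mulrC -ler_pdivrMr//.
  have /ltW /le_trans -> // : d%:R / e < (Num.bound (d%:R / e))%:R.
    by apply: archi_boundP; rewrite divr_ge0// ltW.
  by rewrite ler_nat /N; lia.
pose pt := @grid_point R d N.
have dist (v w : nat -> int) (i : 'I_d.+1) :
    `|v i - w i| <= d%:Z -> `|pt v 0 i - pt w 0 i| <= e.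
  move=> vw; apply: le_trans Ne; rewrite !mxE -mulrBl -rmorphB /= normrM.
  rewrite normfV (gtr0_norm N20) ler_pM2r ?invr_gt0// -intr_norm.
  by rewrite -[d%:R]/(d%:Z%:~R) ler_int.
have ptN v : pt (fun l => - v l) = - pt v.
  by apply/rowP => i; rewrite !mxE rmorphN mulNr.
have pt_face (v : nat -> int) (i : 'I_d.+1) : `|v i| = N.*2%:Z -> `|pt v 0 i| = 1.
  move=> vi; rewrite mxE normrM normfV (gtr0_norm N20) -intr_norm vi.
  by rewrite divff// gt_eqF.
(* For s <= i < d there is no coordinate left, and the zero function is used:
   its sign is decided by the tie-breaking rule alone. *)
pose a i v := sign_of (if insub i is Some i' then h (shrink (pt v)) 0 i' else 0)
                 (shrink (pt v)).
have aloc : face_local d N a.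
  move=> i j v w jd vj vw; rewrite /a.
  suff -> : shrink (pt v) = shrink (pt w) by [].
  apply: (@shrink_local _ _ _ _ (Ordinal (ltnW jd : (j < d.+1)%N))).
    exact: pt_face.
  by move=> l lj; rewrite !mxE vw.
have aopp : face_antipodal d N a.
  move=> i j v jd vj; rewrite /a ptN shrinkN.
  have ptv0 : pt v != 0.
    apply/eqP => /rowP /(_ (Ordinal (ltnW jd : (j < d.+1)%N))) pt0.
    by have := pt_face v (Ordinal (ltnW jd : (j < d.+1)%N)) vj;
      rewrite pt0 mxE normr0 => /eqP; rewrite eq_sym oner_eq0.
  rewrite -sign_ofN ?shrink0// hodd ?shrink0//.
  by congr sign_of; case: insub => [i'|]; rewrite ?mxE ?oppr0.
have [u [u_le ud flips]] := discrete_borsuk_ulam aloc aopp.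
have Ku : box_face (pt u).
  move=> i; rewrite !mxE; case: eqP => [->|_] /=.
    by rewrite ud// divff// gt_eqF.
  rewrite in_itv /= -ler_norml normrM normfV (gtr0_norm N20) -intr_norm.
  by rewrite ler_pdivrMr// mul1r -[N.*2%:R]/(N.*2%:Z%:~R) ler_int.
have [i hi] := sgn _ Ku.
have [p [q [apq pqu]]] := flips i (leq_trans (ltn_ord i) sd).
move/negP: apq; apply; rewrite /a valK; apply/eqP/sign_of_mul; apply: hi => j.
  by apply: dist; have [] := pqu j.
by apply: dist; have [] := pqu j.
Qed.

(** * The genus of coordinate spheres *)

(** The norm of row vectors is the maximum of the absolute values. *)
Definition coordinate_sphere (R : realType) n (U : {set 'I_n}) : set 'rV[R]_n :=
  [set x | `|x| = 1] `&`
  \bigcap_(i in [set i | i \notin U]) [set x : 'rV[R]_n | x 0 i = 0].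

Lemma coordinate_sphere_compact (R : realType) n (U : {set 'I_n}) :
  compact (@coordinate_sphere R n U).
Proof.
apply: bounded_closed_compact.
  by exists 1; split=> // M M1 x [x1 _] /=; rewrite x1 ltW.
apply: closedI.
  apply: (@closed_comp _ _ (fun x : 'rV[R]_n => `|x|) [set 1]) => [x _|].
    exact: norm_continuous.
  exact: closed_eq.
apply: closed_bigI => i _.
apply: (@closed_comp _ _ (fun x : 'rV[R]_n => x 0 i) [set 0]) => [x _|].
  exact: coord_continuous.
exact: closed_eq.
Qed.

(** The linear isomorphism from R^(d+1) to R^U, for #U = d + 1. *)
Definition spread (R : realType) n d (U : {set 'I_n}) (y : 'rV[R]_d.+1) :
    'rV[R]_n :=
  \row_i (if i \in U then y 0 (inord (index i (enum U))) else 0).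

Lemma spread_continuous (R : realType) n d (U : {set 'I_n}) :
  continuous (@spread R n d U).
Proof.
move=> y; apply: (@cvg_row R _ _ (nbhs y)) => i.
under eq_cvg do rewrite mxE; rewrite mxE; case: ifP => _; last exact: cvg_cst.
exact: coord_continuous.
Qed.

Lemma spreadN (R : realType) n d (U : {set 'I_n}) (y : 'rV[R]_d.+1) :
  spread U (- y) = - spread U y.
Proof. by apply/rowP => i; rewrite !mxE; case: ifP => _; rewrite ?mxE ?oppr0. Qed.

Lemma spread_eq0 (R : realType) n d (U : {set 'I_n}) (y : 'rV[R]_d.+1) :
  #|U| = d.+1 -> spread U y = 0 -> y = 0.
Proof.
move=> cardU Uy; apply/rowP => j; rewrite [RHS]mxE.
have jU : (j < size (enum U))%N by rewrite -cardE cardU.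
have /card_gt0P [i0 _] : (0 < #|U|)%N by rewrite cardU.
have /rowP /(_ (nth i0 (enum U) j)) := Uy.
by rewrite !mxE -mem_enum mem_nth// index_uniq ?enum_uniq// inord_val.
Qed.

(** An odd map on the sphere extends radially to R^U without the origin, where
    it takes values of norm 1, hence has no zero. *)
Lemma odd_map_coordinate_sphere (R : realType) n (U : {set 'I_n}) s :
  (0 < #|U|)%N -> odd_map_to_sphere (@coordinate_sphere R n U) s -> (#|U| <= s)%N.
Proof.
case cardU : #|U| => [//|d] _ [f [fcont f1 fodd]]; rewrite leqNgt ltnS.
apply/negP => sd.
pose p (y : 'rV[R]_d.+1) : 'rV[R]_n := `|spread U y|^-1 *: spread U y.
have sp0 (y : 'rV[R]_d.+1) : y != 0 -> `|spread U y| != 0.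
  by rewrite normr_eq0 => y0; apply/eqP => /(spread_eq0 cardU)/eqP; apply/negP.
have pS (y : 'rV[R]_d.+1) : y != 0 -> coordinate_sphere U (p y).
  move=> y0; split; last by move=> i /= /negPf iU; rewrite !mxE iU mulr0.
  by rewrite /= /p normrZ normfV normr_id mulVf// sp0.
have pcont (y : 'rV[R]_d.+1) : y != 0 -> {for y, continuous p}.
  move=> y0.
  have spy (F : set_system 'rV[R]_d.+1) : Filter F ->
      spread U @ F --> spread U y ->
      p @ F --> p y.
    by move=> FF sF; apply: cvgZ => //; apply: cvgV; [exact: sp0|exact: cvg_norm].
  by have := spy _ (nbhs_filter y); apply; exact: spread_continuous.
have [y y0|y y0|y y0 fpy0] := @borsuk_ulam R d s (f \o p) sd.
- have /subspace_continuousP/(_ _ (pS y y0)) fp := fcont.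
  have comp_at (F : set_system 'rV[R]_d.+1) : Filter F ->
      (\forall z \near F, z != 0) -> p @ F --> p y -> f \o p @ F --> f (p y).
    move=> FF Fn0 pF; apply: cvg_comp fp => B /= pB.
    by apply: filterS2 Fn0 (pF _ pB) => z /= z0; apply; exact: pS.
  apply: comp_at (nbhs_filter y) _ (pcont y y0).
  exact: (@cvgr_neq0 _ _ _ (nbhs y) _ id y (@cvg_id _ _)).
- rewrite /= -fodd; last exact: pS.
  by congr f; rewrite /p spreadN normrN scalerN.
- have := f1 _ (pS y y0); rewrite /unit_sphere /= -/(f (p y)) [f _]fpy0.
  rewrite big1; last by move=> j _; rewrite mxE expr0n.
  by move/eqP; rewrite eq_sym oner_eq0.
Qed.

Lemma genus_coordinate_sphere (R : realType) n (U : {set 'I_n}) : (0 < #|U|)%N ->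
  genus_family #|U| (@coordinate_sphere R n U).
Proof.
move=> U0; split.
- exact: coordinate_sphere_compact.
- move=> x [/= x1 xU]; split; first by rewrite /= normrN.
  by move=> i iU; rewrite /= mxE xU// oppr0.
- by case=> /= /eqP; rewrite normr0 eq_sym oner_eq0.
- have /card_gt0P [i iU] := U0; pose v : 'rV[R]_n := delta_mx 0 i.
  have v0 : `|v| != 0.
    rewrite normr_eq0; apply/eqP => /rowP /(_ i); rewrite !mxE !eqxx.
    by move/eqP; rewrite oner_eq0.
  exists (`|v|^-1 *: v); split; first by rewrite /= normrZ normfV normr_id mulVf.
  move=> j /= jU; rewrite !mxE eqxx /=.
  case: eqP => [ji|_]; last by rewrite mulr0.
  by move: jU; rewrite ji iU.
- apply: le_ereal_inf_tmp => _ [s [_ sodd] <-].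
  by rewrite lee_fin ler_nat; exact: odd_map_coordinate_sphere sodd.
Qed.

(** * The degree bound for the Rayleigh quotient *)

(** The arithmetic-geometric mean inequality for the t_p^k, after taking k-th
    roots. *)
Lemma prod_le_mean (R : realFieldType) k (t : 'I_k -> R) : (0 < k)%N ->
    (forall p, 0 <= t p) ->
  \prod_p t p <= (\sum_p t p ^+ k) / k%:R.
Proof.
move=> k0 t0.
have tk0 : forall p, 0 <= t p ^+ k by move=> p; rewrite exprn_ge0.
rewrite -(ler_pXn2r k0) ?nnegrE ?prodr_ge0// ?divr_ge0 ?sumr_ge0//.
rewrite -prodrXl.
have := (@leif_AGM R 'I_k predT (fun p => t p ^+ k) (fun p _ => tk0 p)).1.
by rewrite card_ord.
Qed.

Definition inside n k (U : {set 'I_n}) (t : k.-tuple 'I_n) := all (mem U) t.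

(** By symmetry of w the distinguished index may stand at any position p: the
    transposition of the positions 0 and p reduces to p = 0. *)
Lemma sum_at_position (R : realType) n k (w : tensor R n k) (U : {set 'I_n})
    (i : 'I_n) (p : 'I_k) : symmetric_tensor w -> i \in U ->
  \sum_(t : k.-tuple 'I_n | (tnth t p == i) && inside U t) w t = deg w U i.
Proof.
case: k w p => [|k] w p; first by case: p.
move=> wsym iU; pose sw (t : k.+1.-tuple 'I_n) : k.+1.-tuple 'I_n :=
  [tuple tnth t (tperm ord0 p q) | q < k.+1].
have swK : involutive sw.
  by move=> t; apply: eq_from_tnth => q; rewrite !tnth_mktuple tpermK.
have sw_perm t : perm_eq (sw t) t.
  by apply/tuple_permP; exists (tperm ord0 p).
rewrite /deg (reindex_inj (inv_inj swK)) /=.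
apply: eq_big => [t|t _]; last exact: wsym.
rewrite tnth_mktuple tpermR /inside (perm_all _ (sw_perm t)).
case/tupleP: t => j t; rewrite /= /tnth /=.
by have [->|/negPf ji] := eqVneq j i;
  rewrite ?eqxx ?iU// -[Some j == _]/(j == i) ji.
Qed.

(** Each monomial is at most the mean of the k-th powers of its factors; the
    power x_i^k is then collected once for each of the k positions, every time
    with total weight deg_U(i), which cancels the factor 1/k. *)
Lemma tensor_form_le (R : realType) n k (w w' : tensor R n k) (U : {set 'I_n})
    (x : 'rV[R]_n) : (0 < k)%N -> ~~ odd k -> symmetric_tensor w ->
    (forall t, `|w' t| = w t) -> (forall i, i \notin U -> x 0 i = 0) ->
  `|tensor_form w' x| <= \sum_(i in U) x 0 i ^+ k * deg w U i.
Proof.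
move=> k0 ek wsym ww' xU.
have -> : tensor_form w' x =
    \sum_(t : k.-tuple 'I_n | inside U t) w' t * \prod_(p < k) x 0 (tnth t p).
  rewrite /tensor_form (bigID (inside U)) /= [X in _ + X]big1 ?addr0.
    by apply: eq_bigr => t _; rewrite big_tuple.
  move=> t /allPn [i it /xU xi]; rewrite (big_rem i it) /= xi mul0r mulr0//.
apply: le_trans (ler_norm_sum _ _ _) _.
apply: (@le_trans _ _ (\sum_(t : k.-tuple 'I_n | inside U t)
   w t * ((\sum_(p < k) x 0 (tnth t p) ^+ k) / k%:R))).
  apply: ler_sum => t _; rewrite normrM ww' ler_wpM2l -?ww'//.
  rewrite normr_prod; apply: le_trans (prod_le_mean _ _) _ => //.
  rewrite ler_wpM2r ?invr_ge0//; apply: ler_sum => p _.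
  by rewrite -normrX ger0_norm// exprn_even_ge0.
have -> : \sum_(t : k.-tuple 'I_n | inside U t)
   w t * ((\sum_(p < k) x 0 (tnth t p) ^+ k) / k%:R) =
   (\sum_(p < k) \sum_(t : k.-tuple 'I_n | inside U t)
      x 0 (tnth t p) ^+ k * w t) / k%:R.
  rewrite exchange_big mulr_suml; apply: eq_bigr => t _.
  by rewrite -mulr_suml mulrA [w t * _]mulrC.
have -> : \sum_(p < k) \sum_(t : k.-tuple 'I_n | inside U t)
      x 0 (tnth t p) ^+ k * w t =
    \sum_(p < k) \sum_(i in U) x 0 i ^+ k * deg w U i.
  apply: eq_bigr => p _.
  rewrite (partition_big (fun t : k.-tuple 'I_n => tnth t p) (mem U)) /=;
    last first.
    by move=> t /allP; apply; exact: mem_tnth.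
  apply: eq_bigr => i iU; rewrite -(sum_at_position p wsym iU) mulr_sumr.
  by apply: eq_big => [t|t /andP[_ /eqP ->]]; rewrite // andbC.
by rewrite sumr_const card_ord -[X in X / _]mulr_natr mulfK// pnatr_eq0 -lt0n.
Qed.

Lemma power_form_gt0 (R : realType) n k (x : 'rV[R]_n) : (0 < k)%N -> ~~ odd k ->
  x != 0 -> 0 < power_form k x.
Proof.
move=> k0 ek x0; rewrite lt_neqAle sumr_ge0 ?andbT; last first.
  by move=> i _; exact: exprn_even_ge0.
apply: contra_neq x0 => /esym/eqP; rewrite psumr_eq0; last first.
  by move=> i _; exact: exprn_even_ge0.
move=> /allP x0; apply/rowP => i; have := x0 i (mem_index_enum _).
by rewrite /= expf_eq0 k0 mxE => /eqP.
Qed.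

Lemma rayleigh_le_deg (R : realType) n k (w w' : tensor R n k) (U : {set 'I_n})
    (M : R) (x : 'rV[R]_n) : (0 < k)%N -> ~~ odd k -> symmetric_tensor w ->
    (forall t, `|w' t| = w t) -> (forall i, i \in U -> deg w U i <= M) ->
    x != 0 -> (forall i, i \notin U -> x 0 i = 0) ->
  `|rayleigh w' x| <= M.
Proof.
move=> k0 ek wsym ww' degM x0 xU.
have Gx := power_form_gt0 k0 ek x0.
rewrite /rayleigh normrM normfV (gtr0_norm Gx) ler_pdivrMr//.
apply: le_trans (tensor_form_le k0 ek wsym ww' xU) _.
have -> : power_form k x = \sum_(i in U) x 0 i ^+ k.
  rewrite /power_form (bigID (mem U)) /= addrC big1 ?add0r// => i iU.
  by rewrite xU// expr0n gtn_eqF.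
rewrite mulr_sumr; apply: ler_sum => i iU; rewrite mulrC ler_wpM2r ?degM//.
exact: exprn_even_ge0.
Qed.

(** * The comparison of eigenvalues and degrees *)

Theorem theorem4p4 (R : realType) (n k m : nat) (w : tensor R n k)
    (k_gt0 : (0 < k)%N) (k_even : ~~ odd k) (w_hyp : weighted_hypergraph w)
    (m_ge1 : (1 <= m)%N) (m_le_n : (m <= n)%N) :
  (ereal_sup [set maxe (minmax_eigenvalue w' m) (- maxmin_eigenvalue w' m)
             | w' in signings w]
   <= \big[mine/+oo]_(U : {set 'I_n} | #|U| == m)
        \big[maxe/-oo]_(i in U) (deg w U i)%:E)%E.
Proof.
apply: ge_ereal_sup => _ [w' [_ ww'] <-].
apply: (big_ind (fun b => (_ <= b)%E)) => [|a b ha hb|U /eqP cardU].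
- exact: leey.
- by rewrite le_min ha hb.
have U0 : (0 < #|U|)%N by rewrite cardU.
have /card_gt0P [i0 i0U] := U0.
have [i iU degi] :
    exists2 i, i \in U & forall j, j \in U -> deg w U j <= deg w U i.
  by case: (arg_maxP (deg w U) i0U) => i iU degi; exists i.
apply: (@le_trans _ _ (deg w U i)%:E); last first.
  by rewrite (bigD1 i)//= le_max lexx.
have bound x : coordinate_sphere U x -> `|rayleigh w' x| <= deg w U i.
  move=> [/= x1 xU]; apply: (rayleigh_le_deg k_gt0 k_even w_hyp.1 ww' degi) => //.
  by rewrite -normr_eq0 x1 oner_eq0.
have := genus_coordinate_sphere R U0; rewrite cardU => SU.
rewrite ge_max; apply/andP; split.
  apply: (@le_trans _ _
    (ereal_sup [set (rayleigh w' x)%:E | x in coordinate_sphere U])).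
    by apply: ereal_inf_lbound; exists (coordinate_sphere U).
  apply: ge_ereal_sup => _ [x /bound + <-]; rewrite lee_fin.
  exact: le_trans (ler_norm _).
rewrite leeNl.
apply: (@le_trans _ _
    (ereal_inf [set (rayleigh w' x)%:E | x in coordinate_sphere U])).
  apply: le_ereal_inf_tmp => _ [x /bound + <-]; rewrite -EFinN lee_fin lerNl.
  by apply: le_trans; rewrite -normrN ler_norm.
by apply: ereal_sup_ubound; exists (coordinate_sphere U).
Qed.
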